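(* Assume $x(0)=x'(0)=0$, $y_1(t)\to0$ and $x(t)\to0$ as $t\to\infty$. Let $L_2(t,s)=\omega^2\cos(\omega(t-s))-\omega\sin(\omega(t-s))$. Then $x'(t)\to0$ as $t\to\infty$ if and only if \[ \lim_{t\to\infty}\int_0^tE(t,s)L_2(t,s)y_1(s)\,ds=0. \]
   Context: Standing assumptions: $\omega>0$ is a constant; $p\in C^1([0,\infty))$ with $p(t)>0$ and $p'(t)<0$ for all $t\ge0$, $\int_0^\infty p(t)\,dt=\infty$ and $\int_0^\infty p(t)^2\,dt<\infty$; $f\in L^1_{\mathrm{loc}}([0,\infty))$. $x$ denotes the solution of $x''(t)+p(t)x'(t)+\omega^2x(t)=f(t)$, $t\ge0$. Notation: $E(t,s)=\exp(-\frac12\int_s^tp(\tau)\,d\tau)$ for $0\le s\le t$; $y_1(t)=\int_0^te^{-\omega^2(t-s)}f(s)\,ds$. *)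

(* Defs.v *)
From HB Require Import structures.
From mathcomp Require Import all_boot all_order all_algebra.
From mathcomp Require Import all_classical all_reals all_analysis.
Set Implicit Arguments. Unset Strict Implicit. Unset Printing Implicit Defensive.
Import Order.TTheory GRing.Theory Num.Theory.
Import numFieldNormedType.Exports.
Local Open Scope classical_set_scope.
Local Open Scope ring_scope.

Definition Rint_ab {R : realType} (a b : R) (g : R -> R) : R :=
  Rintegral (@lebesgue_measure R) `[a, b] g.

Definition Efun {R : realType} (p : R -> R) (t s : R) : R :=
  expR (- (2^-1 * Rint_ab s t p)).

Definition y1fun {R : realType} (w : R) (f : R -> R) (t : R) : R :=
  Rint_ab 0 t (fun s => expR (- (w ^+ 2 * (t - s))) * f s).

Definition L2fun {R : realType} (w : R) (t s : R) : R :=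
  w ^+ 2 * cos (w * (t - s)) - w * sin (w * (t - s)).

(* Main.v *)
Require Import Defs.
From HB Require Import structures.
From mathcomp Require Import all_boot all_order all_algebra.
From mathcomp Require Import all_classical all_reals all_analysis.
From mathcomp Require Import measurable_realfun ring lra.
Import Order.TTheory GRing.Theory Num.Theory.
Import numFieldNormedType.Exports.
Local Open Scope classical_set_scope.
Local Open Scope ring_scope.

(** With [z = x' - y1], the corrected velocity [zt = z + (p/2) x] satisfies
    [x' = -(p/2) x + zt + y1] and
    [zt' = -w^2 x - (p/2) zt + w^2 y1 + g] where [g = (p^2/4 + p'/2) x - (p/2) y1],
    and the integral [I] of the statement is the velocity of the same damped
    oscillator with [g] removed.  In coordinates rotating with angular speed [w]
    the difference obeys scalar equations [b' = -(p/2) b + h] with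
    [|h| <= eps (p - p')] eventually.  Such [b] tends to [0]: with
    [Q = exp (1/2 int p)], the function [Q (+-b + eps p - c eps)] is nonincreasing
    for a suitable constant [c], and [Q] tends to infinity.  Hence [zt - I -> 0], so
    [x' - I -> 0]. *)

(** * Integrals as functions of their upper limit *)

Section Integral.
Set Implicit Arguments.
Unset Strict Implicit.
Context {R : realType}.
Implicit Types (g k m p : R -> R) (a b c s t u : R).
Local Notation mu := (@lebesgue_measure R).

Lemma Rint_ab_split a b c g : a <= b -> b <= c ->
  mu.-integrable `[a, c] (EFin \o g) ->
  Rint_ab a c g = Rint_ab a b g + Rint_ab b c g.
Proof.
move=> ab bc ig; apply/eqP; rewrite addrC -subr_eq; apply/eqP.
rewrite /Rint_ab Rintegral_itvB//.
apply: Rintegral_itv_obnd_cbnd; apply: integrableS ig => //=.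
by apply: subset_itv => //; rewrite bnd_simp.
Qed.

Lemma continuous_Rint_ab a g t : a < t ->
  (forall u, a <= u -> mu.-integrable `[a, u] (EFin \o g)) ->
  {for t, continuous (fun u => Rint_ab a u g)}.
Proof.
move=> at_ ig.
have a1 : a <= t + 1 by rewrite (le_trans (ltW at_))// lerDl.
have t1 : t < t + 1 by rewrite ltrDl.
have at1 : a < t + 1 by exact: lt_trans at_ t1.
apply: (within_continuous_continuous at1 (parameterized_integral_continuous a1 (ig _ a1))).
by rewrite in_itv/= at_.
Qed.

Lemma is_derive_Rint_ab a g t : a < t ->
  (forall u, a <= u -> mu.-integrable `[a, u] (EFin \o g)) ->
  {for t, continuous g} ->
  is_derive t 1 (fun u => Rint_ab a u g) (g t).
Proof.
move=> at_ ig cg.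
have a1 : a <= t + 1 by rewrite (le_trans (ltW at_))// lerDl.
have t1 : t < t + 1 by rewrite ltrDl.
have [d e] := continuous_FTC1_closed t1 (ig _ a1) at_ cg.
apply: DeriveDef => //.
by rewrite -derive1E e.
Qed.

Lemma integrableMl_continuous a b k g : {within `[a, b], continuous k} ->
  mu.-integrable `[a, b] (EFin \o g) ->
  mu.-integrable `[a, b] (EFin \o (fun s => k s * g s)).
Proof.
move=> ck ig.
have [M [Mr Mb]] := compact_bounded (continuous_compact ck (@segment_compact R a b)).
have -> : EFin \o (fun s => k s * g s) = ((EFin \o k) \* (EFin \o g))%E by [].
apply: integrableMr => //.
  exact: subspace_continuous_measurable_fun.
exists M; split=> // N /Mb h s s01.
by apply: h; exists s.
Qed.

(** The increment form involves no division and holds trivially at [u = t], so increments of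
    integrals can be estimated directly and the errors added. *)
Lemma is_derive_littleo (f : R -> R) t d :
  (forall e, 0 < e -> \forall u \near t, `|f u - f t - d * (u - t)| <= e * `|u - t|) <->
  is_derive t 1 f d.
Proof.
have E (h : R) : h != 0 -> d - h^-1 *: ((f \o shift t) (h *: 1) - f t) =
    - (h^-1 * (f (t + h) - f t - d * ((t + h) - t))).
  move=> h0 /=; rewrite [h *: 1]mulr1 (addrC h).
  change (d - h^-1 * (f (t + h) - f t) =
    - (h^-1 * (f (t + h) - f t - d * (t + h - t)))).
  by field.
split=> [H|[df dfE] e e0].
  have dfd : h^-1 *: ((f \o shift t) (h *: 1) - f t) @[h --> 0^'] --> d.
    apply/cvgrPdist_le => e e0; have /nbhs0P := H e e0.
    rewrite near_withinE; apply: filterS => h + h0.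
    rewrite (E _ h0) normrN normrM normfV ler_pdivrMl ?normr_gt0//.
    by have -> : t + h - t = h; [ring|rewrite (mulrC `|h|)].
  by apply: DeriveDef; [apply/cvg_ex; exists d|exact: cvg_lim].
have /cvgrPdist_le/(_ e e0) : h^-1 *: ((f \o shift t) (h *: 1) - f t) @[h --> 0^'] --> d.
  by rewrite -dfE; exact: df.
rewrite near_withinE => H; apply/nbhs0P.
apply: filterS H => h H; have [->|h0] := eqVneq h 0.
  by rewrite addr0 !subrr mulr0 subr0 !normr0 mulr0.
have := H h0; rewrite (E _ h0) normrN normrM normfV.
rewrite ler_pdivrMl ?normr_gt0//.
by have -> : t + h - t = h; [ring|rewrite (mulrC `|h|)].
Qed.

Lemma le_norm_Rint_abM m g s u c : s <= u ->
  {within `[s, u], continuous m} -> mu.-integrable `[s, u] (EFin \o g) ->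
  (forall v, s <= v <= u -> `|m v| <= c) ->
  `|Rint_ab s u (fun v => m v * g v)| <= c * Rint_ab s u (fun v => `|g v|).
Proof.
move=> su cm ig mc.
have ing : mu.-integrable `[s, u] (EFin \o (fun v => `|g v|)).
  exact: integrable_norm.
have imng : mu.-integrable `[s, u] (EFin \o (fun v => m v * g v)).
  exact: integrableMl_continuous.
rewrite /Rint_ab (le_trans (le_normr_Rintegral _ _))// -RintegralZl//.
apply: le_Rintegral => //=.
- exact: (@integrable_norm _ _ _ mu `[s, u] (fun v => m v * g v)).
- exact: (integrableZl _ _ ing).
- by move=> v; rewrite in_itv/= normrM => /mc h; rewrite ler_wpM2r.
Qed.

Lemma integrable_subitv g s u : 0 <= s ->
  (forall b, 0 <= b -> mu.-integrable `[0, b] (EFin \o g)) ->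
  mu.-integrable `[s, u] (EFin \o g).
Proof.
move=> s0 ig; have [us|su] := ltP u s.
  by rewrite set_itv_ge ?bnd_simp -?ltNge//; exact: integrable_set0.
apply: integrableS (ig _ (le_trans s0 su)) => //=.
by apply: subset_itv => //; rewrite bnd_simp.
Qed.

(** The endpoints come in either order, so that increments to the left and to the right of a point
    are treated at once. The factor on the right is an increment of the integral of [|g|], which is
    small by continuity even where [g] is unbounded. *)
Lemma le_norm_Rint_abMB m g a b c : 0 <= a -> 0 <= b -> continuous m ->
  (forall u, 0 <= u -> mu.-integrable `[0, u] (EFin \o g)) ->
  (forall v, Num.min a b <= v <= Num.max a b -> `|m v| <= c) ->
  `|Rint_ab 0 b (fun v => m v * g v) - Rint_ab 0 a (fun v => m v * g v)| <=
  c * `|Rint_ab 0 b (fun v => `|g v|) - Rint_ab 0 a (fun v => `|g v|)|.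
Proof.
move=> + + cm ig; wlog ab : a b / a <= b => [H a0 b0 mc|a0 b0].
  have [ab|/ltW ba] := leP a b; first exact: H.
  by rewrite distrC [in leRHS]distrC; apply: H => // v; rewrite minC maxC; exact: mc.
rewrite (min_idPl ab) (max_idPr ab) => mc.
have cmw x y : {within `[x, y], continuous m} by exact: continuous_subspaceT.
have ing u : 0 <= u -> mu.-integrable `[0, u] (EFin \o (fun v => `|g v|)).
  by move=> /ig /integrable_norm; exact.
have imu := integrableMl_continuous (cmw _ _) (ig _ b0).
rewrite (Rint_ab_split a0 ab imu) (Rint_ab_split a0 ab (ing _ b0)).
rewrite addrAC subrr add0r addrAC subrr add0r.
rewrite [in leRHS]ger0_norm; last exact: Rintegral_ge0.
apply: le_norm_Rint_abM => //; exact: integrable_subitv.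
Qed.

(* As [g] is merely integrable, neither integral need be differentiable at [t];
   only their combination is. *)
Lemma is_derive_Rint_abM_sub k g t dk : 0 < t -> continuous k ->
  (forall u, 0 <= u -> mu.-integrable `[0, u] (EFin \o g)) ->
  is_derive t 1 k dk ->
  is_derive t 1 (fun u => Rint_ab 0 u (fun s => k s * g s) - k u * Rint_ab 0 u g)
    (- dk * Rint_ab 0 t g).
Proof.
move=> t0 ck ig dkt.
have ing u : 0 <= u -> mu.-integrable `[0, u] (EFin \o (fun v => `|g v|)).
  by move=> /ig /integrable_norm; exact.
have ikg u : 0 <= u -> mu.-integrable `[0, u] (EFin \o (fun v => k v * g v)).
  by move=> /ig; apply: integrableMl_continuous; exact: continuous_subspaceT.
pose J u := Rint_ab 0 u (fun s => k s * g s).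
(* The weight is recentred at [t]: near [t] it is of order [|u - t|], and the integral of [|g|]
   between [t] and [u] tends to 0, so the increment of [M] is o([u - t]). *)
pose M u := Rint_ab 0 u (fun s => (k s - k t) * g s).
pose G u := Rint_ab 0 u g; pose N u := Rint_ab 0 u (fun v => `|g v|).
have ME u : 0 <= u -> M u = J u - k t * G u.
  move=> u0; rewrite /M /J /G /Rint_ab -RintegralZl//; last exact: ig.
  rewrite -RintegralB//; [|exact: ikg|exact: (integrableZl _ _ (ig _ u0))].
  by apply: eq_Rintegral => s _; rewrite mulrBl.
apply/is_derive_littleo => e e0.
(* The three errors below add up to [eta * (2 * |dk| + eta + 1 + |G t|) * |u - t|]. With [eta <= 1]
   the bracket is at most [K], and [eta * K <= e]. *)
pose K := 2 * `|dk| + 2 + `|G t|.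
have K0 : 0 < K by rewrite /K; have := normr_ge0 dk; have := normr_ge0 (G t); lra.
pose eta := Num.min 1 (e / K).
have eta0 : 0 < eta by rewrite lt_min ltr01 divr_gt0.
have eta1 : eta <= 1 by rewrite ge_min lexx.
have etae : eta * K <= e by rewrite -ler_pdivlMr// ge_min lexx orbT.
have cG := continuous_Rint_ab t0 ig.
have cN := continuous_Rint_ab t0 ing.
have /is_derive_littleo/(_ eta eta0)/nbhs_ballP[r /= r0 Hr] := dkt.
near=> u.
have u0 : 0 < u by near: u; exact: lt_nbhsr.
have ur : ball t r u by near: u; exact: nbhsx_ballx.
have Gu : `|G t - G u| <= eta by near: u; move/cvgrPdist_le : cG; exact.
have Nu : `|N t - N u| <= eta by near: u; move/cvgrPdist_le : cN; exact.
have Hu := Hr _ ur.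
have Mu : `|M u - M t| <= (`|dk| + eta) * `|u - t| * `|N u - N t|.
  apply: le_norm_Rint_abMB => //; [exact: ltW|exact: ltW| |].
    by move=> v; apply: cvgB; [exact: ck|exact: cvg_cst].
  (* A point between [t] and [u] is no farther from [t] than [u], so the first-order expansion of
     [k] is available at [v] with the same [eta]. *)
  move=> v vtu; have vu : `|v - t| <= `|u - t|.
    move: vtu; case: (leP t u) => tu /andP[h1 h2].
      by rewrite !ger0_norm; lra.
    by rewrite !ler0_norm; lra.
  have /Hr Hv : ball t r v.
    by move: ur; rewrite /ball/= distrC [X in _ -> X < _]distrC; exact: le_lt_trans.
  have -> : k v - k t = (k v - k t - dk * (v - t)) + dk * (v - t) by ring.
  rewrite (le_trans (ler_normD _ _))// normrM mulrDl addrC lerD//.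
    by rewrite ler_wpM2l.
  by rewrite (le_trans Hv)// ler_wpM2l// ltW.
rewrite -/(J u) -/(J t) -/(G u) -/(G t).
(* The remainder splits into the increment of [M], the linearisation error of [k] times a bounded
   factor, and [dk * (u - t)] times the small increment of [G]. *)
have -> : J u - k u * G u - (J t - k t * G t) - - dk * G t * (u - t) =
  (M u - M t) - (k u - k t - dk * (u - t)) * G u - dk * (u - t) * (G u - G t).
  by rewrite !ME ?ltW//; ring.
have GuB : `|G u| <= `|G t| + 1.
  have -> : G u = G t - (G t - G u) by ring.
  by rewrite (le_trans (ler_normB _ _))// lerD2l (le_trans Gu).
have U0 := normr_ge0 (u - t).
have D0 := normr_ge0 dk.
apply: le_trans (_ : (`|dk| + eta) * `|u - t| * eta + eta * `|u - t| * (`|G t| + 1)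
    + `|dk| * `|u - t| * eta <= _).
  rewrite !(le_trans (ler_normB _ _))// lerD//; last first.
    by rewrite !normrM distrC ler_wpM2l// ?mulr_ge0// distrC.
  rewrite !(le_trans (ler_normB _ _))// lerD//.
    rewrite (le_trans Mu)// ler_wpM2l// ?mulr_ge0// ?addr_ge0// ?(ltW eta0)//.
    by rewrite distrC.
  by rewrite normrM ler_pM.
have -> : (`|dk| + eta) * `|u - t| * eta + eta * `|u - t| * (`|G t| + 1)
    + `|dk| * `|u - t| * eta = (eta * (2 * `|dk| + eta + 1 + `|G t|)) * `|u - t| by ring.
rewrite ler_wpM2r// (le_trans _ etae)// ler_wpM2l// ?(ltW eta0)// /K; lra.
Unshelve. all: by end_near. Qed.
End Integral.

(** * Derivative rules in pointwise form, and monotonicity from the sign of the derivative *)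

Section Deriv.
Set Implicit Arguments.
Unset Strict Implicit.
Context {R : realType}.
Implicit Types (f g : R -> R) (t df dg c : R).

Lemma is_derive_funM f g t df dg : is_derive t 1 f df -> is_derive t 1 g dg ->
  is_derive t 1 (fun s => f s * g s) (df * g t + f t * dg).
Proof.
move=> Hf Hg; apply: is_derive_eq (is_deriveM Hf Hg) _.
by rewrite addrC mulrC.
Qed.

Lemma is_derive_funD f g t df dg : is_derive t 1 f df -> is_derive t 1 g dg ->
  is_derive t 1 (fun s => f s + g s) (df + dg).
Proof. exact: is_deriveD. Qed.

Lemma is_derive_funB f g t df dg : is_derive t 1 f df -> is_derive t 1 g dg ->
  is_derive t 1 (fun s => f s - g s) (df - dg).
Proof. exact: is_deriveB. Qed.

Lemma is_derive_funN f t df : is_derive t 1 f df ->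
  is_derive t 1 (fun s => - f s) (- df).
Proof. exact: is_deriveN. Qed.

Lemma is_derive_mull c f t df : is_derive t 1 f df ->
  is_derive t 1 (fun s => c * f s) (c * df).
Proof. exact: is_deriveZ. Qed.

Lemma is_derive_linear c t : is_derive t 1 (fun s => c * s) c.
Proof. by apply: is_derive_eq (is_derive_mull c (is_derive_id t 1)) _; rewrite mulr1. Qed.

Lemma is_derive_expR_comp f t df : is_derive t 1 f df ->
  is_derive t 1 (fun s => expR (f s)) (expR (f t) * df).
Proof. exact: is_derive1_comp. Qed.

Lemma is_derive_continuous f t df : is_derive t 1 f df -> {for t, continuous f}.
Proof. by move=> [Hf _]; apply: differentiable_continuous; exact/derivable1_diffP. Qed.

Lemma ler0_is_derive_nincr f (f' : R -> R) (T a b : R) :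
  (forall t : R, T < t -> is_derive t 1 f (f' t)) ->
  (forall t : R, T < t -> f' t <= 0) -> T < a -> a <= b -> f b <= f a.
Proof.
move=> Hf f'0 Ta ab.
have Tc c : c \in `[a, b] -> T < c.
  by rewrite in_itv/= => /andP[+ _]; exact: lt_le_trans.
have [c /Tc Tc' E] : exists2 c, c \in `[a, b] & f b - f a = f' c * (b - a).
  apply: MVT_segment => // [c cab|].
    by apply/Hf/Tc; exact: (subset_itv_oo_cc cab).
  apply: continuous_in_subspaceT => c; rewrite inE => /Tc /Hf.
  exact: is_derive_continuous.
by rewrite -subr_le0 E mulr_le0_ge0 ?f'0// subr_ge0.
Qed.

End Deriv.

(** * Decay for the scalar damped equation *)

(** Here [b] already carries the integrating factor [exp (P / 2)], so no damping term is left in its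
    equation; the conclusion divides the factor out again. *)
Lemma cvg0_damped {R : realType} (P p dp b h : R -> R) (C : R) :
  (forall t : R, 0 < t -> is_derive t 1 P (p t)) ->
  (forall t : R, 0 < t -> is_derive t 1 p (dp t)) ->
  (forall t : R, 0 < t -> 0 <= p t <= C) ->
  P t @[t --> +oo%R] --> +oo%R ->
  (forall t : R, 0 < t -> is_derive t 1 b (expR (2^-1 * P t) * h t)) ->
  (forall e : R, 0 < e -> \forall t \near +oo%R, `|h t| <= e * (p t - dp t)) ->
  expR (- (2^-1 * P t)) * b t @[t --> +oo%R] --> 0.
Proof.
move=> HP Hp pC Py Hb hle.
pose Q t := expR (2^-1 * P t).
have C0 : 0 <= C by have /andP[h1 h2] := pC 1 ltr01; exact: le_trans h1 h2.
apply/cvgr0Pnorm_le => e e0.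
(* The value of [c] makes [d p + d p^2 / 2 - c d p / 2 <= 0] whenever [0 <= p <= C]. The value of
   [d] gives [c * d = e / 2], the share of the error that survives division by [Q]. *)
pose c := 2 + C; pose d := e / (2 * c).
have c0 : 0 < c by rewrite /c; lra.
have d0 : 0 < d by rewrite divr_gt0// mulr_gt0.
have [T0 [_ HT0]] := hle d d0.
pose T := Num.max 0 T0.
have T0T : 0 <= T by rewrite le_max lexx.
have TT (t : R) : T < t -> 0 < t /\ `|h t| <= d * (p t - dp t).
  by rewrite gt_max => /andP[? ?]; split=> //; exact: HT0.
pose T1 := T + 1.
have TT1 : T < T1 by rewrite ltrDl.
have T1_gt0 := le_lt_trans T0T TT1.
(* One-sided estimate, applied below to [b] and to [- b]. *)
have dec (f dh : R -> R) : (forall t : R, 0 < t -> is_derive t 1 f (Q t * dh t)) ->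
    (forall t : R, T < t -> dh t <= d * (p t - dp t)) ->
    forall t : R, T1 <= t -> f t <= f T1 + d * C * Q T1 + c * d * Q t.
  move=> Hf dhle t T1t.
  (* The summand [d p Q] absorbs the term [- d p'] in the bound on [dh]. *)
  pose u s := f s + d * (p s * Q s) - c * d * Q s.
  have t0 : 0 < t := lt_le_trans T1_gt0 T1t.
  have : u t <= u T1.
    apply: (@ler0_is_derive_nincr R u (fun s => Q s *
      (dh s + d * (dp s + p s * (2^-1 * p s)) - c * d * (2^-1 * p s))) T).
    - move=> s /TT[s0 _].
      have HQ : is_derive s 1 Q (Q s * (2^-1 * p s)).
        by apply: is_derive_expR_comp; apply: is_derive_mull; exact: HP.
      have Hu := is_derive_funB (is_derive_funD (Hf s s0)
        (is_derive_mull d (is_derive_funM (Hp s s0) HQ))) (is_derive_mull (c * d) HQ).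
      by apply: is_derive_eq Hu _; ring.
    - move=> s Ts; have [s0 _] := TT s Ts.
      have /andP[p0 pc] := pC s s0.
      rewrite mulr_ge0_le0 ?expR_ge0//.
      have := dhle s Ts; have : d * (p s * p s) <= d * (p s * C) by rewrite !ler_wpM2l// ltW.
      have : 0 <= d * p s by rewrite mulr_ge0// ltW.
      rewrite /c; nra.
    - exact: TT1.
    - exact: T1t.
  rewrite /u => ut.
  have /andP[p0 _] := pC t t0.
  have : 0 <= d * (p t * Q t) by exact: mulr_ge0 (ltW d0) (mulr_ge0 p0 (expR_ge0 _)).
  have /andP[p1 p1C] := pC T1 T1_gt0.
  have : d * (p T1 * Q T1) <= d * C * Q T1 by rewrite mulrA ler_wpM2r ?expR_ge0// ler_wpM2l// ltW.
  have : 0 <= c * d * Q T1 by exact: mulr_ge0 (ltW (mulr_gt0 c0 d0)) (expR_ge0 _).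
  lra.
have bb (t : R) : T1 <= t -> `|b t| <= `|b T1| + d * C * Q T1 + c * d * Q t.
  move=> T1t; rewrite ler_norml lerNl; apply/andP; split.
    apply: le_trans (dec (fun s => - b s) (fun s => - h s) _ _ t T1t) _.
    - move=> s s0; rewrite mulrN; exact/is_derive_funN/Hb.
    - by move=> s /TT[_]; rewrite ler_norml => /andP[]; lra.
    - by rewrite !lerD2r -normrN ler_norm.
  apply: le_trans (dec b h Hb _ t T1t) _.
    by move=> s /TT[_]; exact: le_trans (ler_norm _).
  by rewrite !lerD2r ler_norm.
(* The terms of the bound that do not grow with [t], with 1 added to make [K] positive; divided by
   [Q t] they drop below [e / 2]. *)
pose K := `|b T1| + d * C * Q T1 + 1.
have K0 : 0 < K.
  rewrite /K; have : 0 <= d * C * Q T1 by exact: mulr_ge0 (mulr_ge0 (ltW d0) C0) (expR_ge0 _).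
  have := normr_ge0 (b T1); lra.
have Q0 : expR (- (2^-1 * P t)) @[t --> +oo%R] --> 0.
  have Py2 : 2^-1 * P t @[t --> +oo%R] --> +oo%R.
    apply/cvgryPge => A; move/cvgryPge/(_ (2 * A)) : Py; by apply: filterS => t; lra.
  exact: (cvg_comp _ _ Py2 (@cvgr_expR R)).
have QK : \forall t \near +oo%R, expR (- (2^-1 * P t)) <= e / 2 / K.
  have eK : 0 < e / 2 / K by rewrite !divr_gt0.
  move/cvgr0Pnorm_le/(_ _ eK) : Q0; apply: filterS => t.
  exact: le_trans (ler_norm _).
near=> t.
have T1t : T1 <= t by near: t; exact: nbhs_pinfty_ge (num_real _).
have Qt : expR (- (2^-1 * P t)) <= e / 2 / K by near: t.
have E0 := expR_gt0 (- (2^-1 * P t)).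
rewrite normrM (gtr0_norm E0) (le_trans (ler_wpM2l (ltW E0) (bb t T1t)))//.
rewrite mulrDr (mulrC (c * d)) mulrA -expRD addNr expR0 mul1r.
have -> : c * d = e / 2 by rewrite /d; field; rewrite gt_eqF.
have : expR (- (2^-1 * P t)) * K <= e / 2 by rewrite -ler_pdivlMr.
rewrite /K; nra.
Unshelve. all: by end_near. Qed.

(** Monotone convergence along the segments [[0, n]] gives divergence at integers, and [p >= 0]
    carries it over to real [t]. *)
Lemma cvgy_Rint_ab {R : realType} (p : R -> R) :
  (forall t : R, 0 <= t -> (@lebesgue_measure R).-integrable `[0, t] (EFin \o p)) ->
  (forall t : R, 0 <= t -> 0 <= p t) ->
  (\int[@lebesgue_measure R]_(s in `[0%R, +oo[%classic) (p s)%:E = +oo)%E ->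
  Rint_ab 0 t p @[t --> +oo%R] --> +oo%R.
Proof.
move=> ip p0 py.
have : (\int[@lebesgue_measure R]_(s in `[0%R, n%:R]%classic) (p s)%:E @[n --> \oo] --> +oo)%E.
  rewrite -py.
  have -> : `[0%R, +oo[%classic = \bigcup_n `[0%R, n%:R : R]%classic.
    by rewrite itv_bndy_bigcup_BRight; apply: eq_bigcupr => n _; rewrite add0r.
  apply: ge0_nondecreasing_set_cvg_integral => //.
  - move=> m n mn; apply/subsetPset; apply: subset_itvl.
    by rewrite bnd_simp ler_nat.
  - by move=> n; have /integrableP[] := ip n%:R (ler0n _ _).
  - by move=> n s /=; rewrite in_itv/= => /andP[s0 _]; rewrite lee_fin p0.
move=> /cvgeyPge H; apply/cvgryPge => A.
have [n _ /(_ n (leqnn n)) /= Hn] := H A.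
near=> t.
have nt : n%:R <= t by near: t; exact: nbhs_pinfty_ge (num_real _).
rewrite (Rint_ab_split (ler0n _ n) nt); last by apply: ip; rewrite (le_trans _ nt).
apply: (@le_trans _ _ (Rint_ab 0 n%:R p)).
  rewrite -lee_fin /Rint_ab /Rintegral fineK//.
  by apply: integrable_fin_num => //; exact: ip.
rewrite lerDl; apply: Rintegral_ge0 => s /=; rewrite in_itv/= => /andP[ns _].
by rewrite p0// (le_trans _ ns).
Unshelve. all: by end_near. Qed.

(** * Products, null limits and integrability on the half-line *)

Section Oscillator.
Set Implicit Arguments.
Unset Strict Implicit.
Context {R : realType}.
Local Notation mu := (@lebesgue_measure R).

Lemma within_continuousM (A : set R) (g h : R -> R) :
  {within A, continuous g} -> {within A, continuous h} ->
  {within A, continuous (fun t => g t * h t)}.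
Proof.
move=> cg ch t; exact: (@continuousM R (subspace A) g h t (cg t) (ch t)).
Qed.

Lemma cvg0_mul_bounded (b f : R -> R) (C : R) :
  (\forall t \near +oo%R, `|b t| <= C) -> f t @[t --> +oo%R] --> 0 ->
  b t * f t @[t --> +oo%R] --> 0.
Proof.
move=> bC f0; apply/cvgr0Pnorm_le => e e0.
have C1 : 0 < `|C| + 1 by rewrite ltr_wpDl.
have eC : 0 < e / (`|C| + 1) by rewrite divr_gt0.
move/cvgr0Pnorm_le/(_ _ eC) : f0 => f0.
near=> t.
have bt : `|b t| <= C by near: t.
have ft : `|f t| <= e / (`|C| + 1) by near: t.
rewrite normrM (le_trans (ler_pM _ _ (_ : _ <= `|C| + 1) ft))//.
  by rewrite (le_trans bt)// (le_trans (ler_norm C))// lerDl.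
by rewrite mulrC divfK// gt_eqF.
Unshelve. all: by end_near. Qed.

Lemma integrable_continuous_itvcy (g : R -> R) (u : R) : 0 <= u ->
  {within `[0%R, +oo[%classic, continuous g} -> mu.-integrable `[0, u] (EFin \o g).
Proof.
move=> u0 cg; apply: continuous_compact_integrable; first exact: segment_compact.
by apply: continuous_subspaceW cg; apply: subset_itvl; rewrite bnd_simp.
Qed.

(** * The filtered forcing [y1] *)

Context (w : R) (f : R -> R)
  (f_int : forall t : R, 0 <= t -> mu.-integrable `[0, t] (EFin \o f)).

Let ef s := expR (w ^+ 2 * s) * f s.

Lemma continuous_expR_linear (c : R) : continuous (fun s => expR (c * s)).
Proof.
move=> s; apply: continuous_comp; last exact: continuous_expR.
exact: is_derive_continuous (is_derive_linear c s).
Qed.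

Lemma integrable_expRM (t : R) : 0 <= t -> mu.-integrable `[0, t] (EFin \o ef).
Proof.
move=> /f_int; apply: integrableMl_continuous; apply: continuous_subspaceT.
exact: continuous_expR_linear.
Qed.

(** Once the exponential in [t] is factored out, [t] occurs in the integral only as its upper
    limit. *)
Lemma y1funE (t : R) : 0 <= t ->
  y1fun w f t = expR (- w ^+ 2 * t) * Rint_ab 0 t ef.
Proof.
move=> t0; rewrite /y1fun /Rint_ab -RintegralZl//; last exact: integrable_expRM.
apply: eq_Rintegral => s _; rewrite /ef mulrA -expRD.
by congr (expR _ * _); ring.
Qed.

Lemma within_continuous_y1fun (u : R) : 0 <= u ->
  {within `[0%R, u], continuous (y1fun w f)}.
Proof.
move=> u0; apply: (@subspace_eq_continuous _ _ _ (fun t => expR (- w ^+ 2 * t) * Rint_ab 0 t ef)).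
  by move=> t; rewrite inE/= in_itv/= => /andP[t0 _]; exact/esym/y1funE.
apply: within_continuousM.
  exact/continuous_subspaceT/continuous_expR_linear.
exact: parameterized_integral_continuous u0 (integrable_expRM u0).
Qed.

(** Formally [y1' = f - w^2 y1], which need not hold at every point for an integrable [f]; in the
    difference the rough parts cancel. This is the combined derivative rule with [k = exp (- w^2 s)]
    and [g = ef], for which [k * g = f]. *)
Lemma is_derive_Rint_sub_y1fun (t : R) : 0 < t ->
  is_derive t 1 (fun u => Rint_ab 0 u f - y1fun w f u) (w ^+ 2 * y1fun w f t).
Proof.
move=> t0.
have H := is_derive_Rint_abM_sub t0 (@continuous_expR_linear (- w ^+ 2)) integrable_expRM
  (is_derive_expR_comp (is_derive_linear (- w ^+ 2) t)).
have -> : w ^+ 2 * y1fun w f t = - (expR (- w ^+ 2 * t) * - w ^+ 2) * Rint_ab 0 t ef.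
  by rewrite y1funE ?ltW//; ring.
apply: near_eq_is_derive H.
near=> u.
have u0 : 0 <= u by apply: ltW; near: u; exact: lt_nbhsr.
rewrite y1funE//; congr (_ - _).
apply: eq_Rintegral => s _; rewrite /ef mulrA -expRD.
by rewrite mulNr addNr expR0 mul1r.
Unshelve. all: by end_near. Qed.


(** * The velocity equation and the weighted forcing integrals *)

Context (p dp x dx : R -> R)
  (cp : {within `[0%R, +oo[%classic, continuous p})
  (Hp : forall t : R, 0 < t -> is_derive t 1 p (dp t))
  (p_gt0 : forall t : R, 0 <= t -> 0 < p t)
  (dp_lt0 : forall t : R, 0 <= t -> dp t < 0)
  (py : (\int[mu]_(s in `[0%R, +oo[%classic) (p s)%:E = +oo)%E)
  (cx : {within `[0%R, +oo[%classic, continuous x})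
  (Hx : forall t : R, 0 < t -> is_derive t 1 x (dx t))
  (cdx : {within `[0%R, +oo[%classic, continuous dx})
  (Hdx : forall t : R, 0 <= t ->
     dx t = dx 0 + Rint_ab 0 t (fun s => f s - p s * dx s - w ^+ 2 * x s)).

Local Notation y1 := (y1fun w f).
Let P t := Rint_ab 0 t p.
Let Q t := expR (2^-1 * P t).

Lemma continuous_itvcy_at (g : R -> R) (t : R) : 0 < t ->
  {within `[0%R, +oo[%classic, continuous g} -> {for t, continuous g}.
Proof.
by move=> t0 /continuous_within_itvcyP[+ _]; apply; rewrite in_itv/= t0.
Qed.

Lemma within_continuous_seg (g : R -> R) (u : R) :
  {within `[0%R, +oo[%classic, continuous g} -> {within `[0%R, u], continuous g}.
Proof. by apply: continuous_subspaceW; apply: subset_itvl; rewrite bnd_simp. Qed.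

Lemma integrable_damping (t : R) : 0 <= t -> mu.-integrable `[0, t] (EFin \o p).
Proof. by move=> t0; exact: integrable_continuous_itvcy. Qed.

Lemma is_derive_int_damping (t : R) : 0 < t -> is_derive t 1 P (p t).
Proof.
move=> t0; apply: is_derive_Rint_ab => //; first exact: integrable_damping.
exact: continuous_itvcy_at.
Qed.

Lemma damping_le (t : R) : 0 < t -> 0 <= p t <= p 0.
Proof.
move=> t0; rewrite ltW ?p_gt0 ?(ltW t0)//=.
have [s|c c0t E] := @MVT R p dp 0 t t0 _ (within_continuous_seg cp).
  by rewrite in_itv/= => /andP[s0 _]; exact: Hp.
have c0 : 0 <= c by move: c0t; rewrite in_itv/= => /andP[/ltW].
by rewrite -subr_le0 E subr0 nmulr_rle0 ?ltW// dp_lt0.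
Qed.

(** [f] enters [x'] only through its integral, and subtracting [y1] turns that integral into a
    differentiable function. The rest of the integrand, [r], is continuous. *)
Lemma is_derive_velocity (t : R) : 0 < t ->
  is_derive t 1 (fun u => dx u - y1 u) (w ^+ 2 * y1 t - p t * dx t - w ^+ 2 * x t).
Proof.
move=> t0.
pose r s := p s * dx s + w ^+ 2 * x s.
have cr : {within `[0%R, +oo[%classic, continuous r}.
  apply: (@within_continuousD _ _ _ _ (fun s => p s * dx s) (fun s => w ^+ 2 * x s)).
    exact: within_continuousM.
  apply: within_continuousM => //; exact: cst_continuous.
have rint u : 0 <= u -> mu.-integrable `[0, u] (EFin \o r).
  by move=> u0; exact: integrable_continuous_itvcy.
have Hr := is_derive_Rint_ab t0 rint (continuous_itvcy_at t0 cr).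
have H := is_derive_funD (is_derive_cst (dx 0) t 1)
  (is_derive_funB (is_derive_Rint_sub_y1fun t0) Hr).
have -> : w ^+ 2 * y1 t - p t * dx t - w ^+ 2 * x t = 0 + (w ^+ 2 * y1 t - r t).
  by rewrite /r; ring.
apply: near_eq_is_derive H.
near=> u.
have u0 : 0 <= u by apply: ltW; near: u; exact: lt_nbhsr.
rewrite (Hdx u0) -[cst _ u]/(dx 0).
have -> : Rint_ab 0 u (fun s => f s - p s * dx s - w ^+ 2 * x s) = Rint_ab 0 u f - Rint_ab 0 u r.
  rewrite /Rint_ab -RintegralB//; [|exact: f_int|exact: rint].
  by apply: eq_Rintegral => s _; rewrite /r; ring.
by ring.
Unshelve. all: by end_near. Qed.

Let S_ (k : R -> R) t := Rint_ab 0 t (fun s => Q s * k s * y1 s).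

Lemma integrable_forcing (k : R -> R) (u : R) : continuous k -> 0 <= u ->
  mu.-integrable `[0, u] (EFin \o (fun s => Q s * k s * y1 s)).
Proof.
move=> ck u0; apply: continuous_compact_integrable; first exact: segment_compact.
apply: within_continuousM; last exact: within_continuous_y1fun.
apply: within_continuousM; last exact: continuous_subspaceT.
move=> t; apply: continuous_comp; last exact: continuous_expR.
apply: within_continuousM; first exact: cst_continuous.
exact: parameterized_integral_continuous u0 (integrable_damping u0).
Qed.

Lemma is_derive_forcing (k : R -> R) (t : R) : continuous k -> 0 < t ->
  is_derive t 1 (S_ k) (Q t * k t * y1 t).
Proof.
move=> ck t0; apply: (@is_derive_Rint_ab _ 0 (fun s => Q s * k s * y1 s)) => //.
  by move=> u; exact: integrable_forcing.
have cy : {for t, continuous y1}.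
  have t1 : 0 < t + 1 by rewrite addr_gt0.
  apply: (within_continuous_continuous t1 (within_continuous_y1fun (ltW t1))).
  by rewrite in_itv/= t0 ltrDl/=.
apply: cvgM cy; apply: cvgM; last exact: ck.
apply: is_derive_continuous; apply: is_derive_expR_comp; apply: is_derive_mull.
exact: is_derive_int_damping.
Qed.

(* L2 (t, s) = cos (w t) k1 (s) + sin (w t) k2 (s) *)
Let k1 s := w ^+ 2 * cos (w * s) + w * sin (w * s).
Let k2 s := w ^+ 2 * sin (w * s) - w * cos (w * s).

Lemma is_derive_cosw (t : R) : is_derive t 1 (fun s => cos (w * s)) (- (w * sin (w * t))).
Proof.
apply: is_derive_eq (is_derive1_comp (is_derive_cos _) (is_derive_linear w t)) _.
by rewrite mulNr mulrC.
Qed.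

Lemma is_derive_sinw (t : R) : is_derive t 1 (fun s => sin (w * s)) (w * cos (w * t)).
Proof.
apply: is_derive_eq (is_derive1_comp (is_derive_sin _) (is_derive_linear w t)) _.
by rewrite mulrC.
Qed.

Lemma continuous_k1 : continuous k1.
Proof.
move=> t; exact: is_derive_continuous (is_derive_funD
  (is_derive_mull _ (is_derive_cosw t)) (is_derive_mull _ (is_derive_sinw t))).
Qed.

Lemma continuous_k2 : continuous k2.
Proof.
move=> t; exact: is_derive_continuous (is_derive_funB
  (is_derive_mull _ (is_derive_sinw t)) (is_derive_mull _ (is_derive_cosw t))).
Qed.

(** Both factors of the kernel separate: [E(t, s) = Q(s) / Q(t)] by additivity of the integral of
    [p], and [L2] by the addition formulas. *)
Lemma kernel_integralE (t : R) : 0 <= t ->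
  Rint_ab 0 t (fun s => Efun p t s * L2fun w t s * y1 s) =
  expR (- (2^-1 * P t)) * (cos (w * t) * S_ k1 t + sin (w * t) * S_ k2 t).
Proof.
move=> t0; have i1 := integrable_forcing continuous_k1 t0.
have i2 := integrable_forcing continuous_k2 t0.
set e := expR _; rewrite mulrDr !mulrA /S_ /Rint_ab -!RintegralZl//.
rewrite -RintegralD//; [|exact: (integrableZl _ _ i1)|exact: (integrableZl _ _ i2)].
apply: eq_Rintegral => s; rewrite inE/= in_itv/= => /andP[s0 st].
have -> : Efun p t s = expR (- (2^-1 * P t)) * Q s.
  rewrite /Efun /Q -expRD /P (Rint_ab_split s0 st (integrable_damping t0)).
  by congr expR; ring.
rewrite /L2fun /k1 /k2 (mulrBr w) cosB sinB.
by rewrite -/e; ring.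
Qed.

(** * Rotating coordinates *)

Let zt t := dx t - y1 t + 2^-1 * (p t * x t).
Let g1 t := (p t * p t / 4 + dp t / 2) * x t - p t / 2 * y1 t.
(* The two rotated components, multiplied by Q, of the difference between
   (x, zt) and the solution driven by y1 without the term g1. *)
Let phi1 t := Q t * (zt t * cos (w * t) + w * (x t * sin (w * t))) - S_ k1 t.
Let phi2 t := Q t * (zt t * sin (w * t) - w * (x t * cos (w * t))) - S_ k2 t.

Lemma is_derive_weight (t : R) : 0 < t -> is_derive t 1 Q (Q t * (2^-1 * p t)).
Proof.
by move=> t0; apply: is_derive_expR_comp; apply: is_derive_mull; exact: is_derive_int_damping.
Qed.

Lemma is_derive_zt (t : R) : 0 < t -> is_derive t 1 zt
  ((w ^+ 2 * y1 t - p t * dx t - w ^+ 2 * x t) + 2^-1 * (dp t * x t + p t * dx t)).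
Proof.
move=> t0; apply: is_derive_funD; first exact: is_derive_velocity.
by apply/is_derive_mull/is_derive_funM; [exact: Hp|exact: Hx].
Qed.

(** The rotation cancels the coupling of [x] and [zt] through [w], the weight [Q] cancels the
    damping [p / 2], and [S_ k1] cancels the terms [w^2 y1] of [zt'] and [y1] of [x']. Only [g1]
    remains. *)
Lemma is_derive_phi1 (t : R) : 0 < t ->
  is_derive t 1 phi1 (Q t * (g1 t * cos (w * t))).
Proof.
move=> t0.
have H := is_derive_funB (is_derive_funM (is_derive_weight t0)
  (is_derive_funD (is_derive_funM (is_derive_zt t0) (is_derive_cosw t))
     (is_derive_mull w (is_derive_funM (Hx t0) (is_derive_sinw t)))))
  (is_derive_forcing continuous_k1 t0).
by apply: is_derive_eq H _; rewrite /k1 /g1 /zt; field.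
Qed.

Lemma is_derive_phi2 (t : R) : 0 < t ->
  is_derive t 1 phi2 (Q t * (g1 t * sin (w * t))).
Proof.
move=> t0.
have H := is_derive_funB (is_derive_funM (is_derive_weight t0)
  (is_derive_funB (is_derive_funM (is_derive_zt t0) (is_derive_sinw t))
     (is_derive_mull w (is_derive_funM (Hx t0) (is_derive_cosw t)))))
  (is_derive_forcing continuous_k2 t0).
by apply: is_derive_eq H _; rewrite /k2 /g1 /zt; field.
Qed.

(** * Smallness of the perturbation and passage to the limit *)

Context (y0 : y1 t @[t --> +oo%R] --> 0) (x0 : x t @[t --> +oo%R] --> 0).

(** Since [p^2 <= p(0) p] and [|p'| = - p'], the coefficients of [x] and [y1] in [g1] add up in
    absolute value to at most [(1 + p(0)) (p - p')], while [x] and [y1] tend to 0. This dictates the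
    choice of [d]. *)
Lemma perturbation_small (e : R) : 0 < e ->
  \forall t \near +oo%R, `|g1 t| <= e * (p t - dp t).
Proof.
move=> e0; have C0 := p_gt0 (lexx 0).
pose d := e / (1 + p 0).
have d0 : 0 < d by rewrite divr_gt0 ?addr_gt0.
move/cvgr0Pnorm_le/(_ _ d0) : y0 => y0'; move/cvgr0Pnorm_le/(_ _ d0) : x0 => x0'.
near=> t.
have t0 : 0 < t by near: t; exact: nbhs_pinfty_gt (num_real _).
have yt : `|y1 t| <= d by near: t.
have xt : `|x t| <= d by near: t.
have /andP[pt pC] := damping_le t0.
have dpt := dp_lt0 (ltW t0).
have -> : e = d * (1 + p 0) by rewrite /d divfK// gt_eqF// addr_gt0.
rewrite (le_trans (ler_normB _ _))// normrM [X in _ + X]normrM.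
have -> : `|p t / 2| = p t / 2 by rewrite ger0_norm// divr_ge0.
have A : `|p t * p t / 4 + dp t / 2| <= p 0 * p t / 4 - dp t / 2.
  rewrite (le_trans (ler_normD _ _))// lerD//.
    by rewrite ger0_norm ?divr_ge0 ?mulr_ge0// ler_wpM2r// ler_wpM2r.
  by rewrite ltr0_norm// pmulr_llt0.
have B : `|p t * p t / 4 + dp t / 2| * `|x t| <= (p 0 * p t / 4 - dp t / 2) * d by rewrite ler_pM.
have C : p t / 2 * `|y1 t| <= p t / 2 * d by rewrite ler_wpM2l ?divr_ge0.
have D : 0 <= d * (p 0 * p t) := mulr_ge0 (ltW d0) (mulr_ge0 (ltW C0) pt).
have E : 0 <= d * p t := mulr_ge0 (ltW d0) pt.
have Ndp : 0 <= - dp t by rewrite oppr_ge0 ltW.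
have F : 0 <= d * - dp t := mulr_ge0 (ltW d0) Ndp.
have G : 0 <= d * (p 0 * - dp t) := mulr_ge0 (ltW d0) (mulr_ge0 (ltW C0) Ndp).
nra.
Unshelve. all: by end_near. Qed.

Lemma dx_sub_kernel_integral_cvg0 :
  dx t - Rint_ab 0 t (fun s => Efun p t s * L2fun w t s * y1 s) @[t --> +oo%R] --> 0.
Proof.
have Py : P t @[t --> +oo%R] --> +oo%R.
  by apply: cvgy_Rint_ab => // [t|t t0]; [exact: integrable_damping|exact/ltW/p_gt0].
have damp (k phi : R -> R) : (forall t, `|k t| <= 1) ->
    (forall t : R, 0 < t -> is_derive t 1 phi (Q t * (g1 t * k t))) ->
    expR (- (2^-1 * P t)) * phi t @[t --> +oo%R] --> 0.
  move=> kle1 Hphi.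
  apply: (cvg0_damped is_derive_int_damping Hp damping_le Py Hphi) => e /perturbation_small.
  by apply: filterS => t; apply: le_trans; rewrite normrM ler_piMr.
have cos1 (t : R) : `|cos (w * t)| <= 1 by exact: cos_max.
have sin1 (t : R) : `|sin (w * t)| <= 1 by exact: sin_max.
have D1 := damp _ _ cos1 is_derive_phi1.
have D2 := damp _ _ sin1 is_derive_phi2.
have bnd (b h : R -> R) C : (forall t, 0 < t -> `|b t| <= C) -> h t @[t --> +oo%R] --> 0 ->
    b t * h t @[t --> +oo%R] --> 0.
  move=> bC; apply: (@cvg0_mul_bounded _ _ C); near=> t; apply: bC.
  by near: t; exact: nbhs_pinfty_gt (num_real _).
have E1 := bnd _ _ 1 (fun t _ => cos1 t) D1.
have E2 := bnd _ _ 1 (fun t _ => sin1 t) D2.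
have E3 : 2^-1 * p t * x t @[t --> +oo%R] --> 0.
  apply: (bnd (fun t => 2^-1 * p t) _ (p 0)) => // t /damping_le /andP[pt pC].
  by rewrite ger0_norm ?mulr_ge0//; lra.
(* Rotating back: by [cos^2 + sin^2 = 1] the first two terms equal [zt] minus the kernel integral,
   and the last two turn [zt] into [x']. *)
pose r t := cos (w * t) * (expR (- (2^-1 * P t)) * phi1 t)
  + sin (w * t) * (expR (- (2^-1 * P t)) * phi2 t) + y1 t - 2^-1 * p t * x t.
have r0 : r t @[t --> +oo%R] --> 0.
  have := cvgB (cvgD (cvgD E1 E2) y0) E3; rewrite !addr0 subr0; exact.
suff rE : \forall t \near +oo%R, r t =
    dx t - Rint_ab 0 t (fun s => Efun p t s * L2fun w t s * y1 s).
  exact: cvg_trans (near_eq_cvg rE) r0.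
near=> t.
have t0 : 0 < t by near: t; exact: nbhs_pinfty_gt (num_real _).
rewrite kernel_integralE ?ltW//.
have Qn : expR (- (2^-1 * P t)) * Q t = 1 by rewrite -expRD addNr expR0.
have cs : cos (w * t) * cos (w * t) + sin (w * t) * sin (w * t) = 1.
  by rewrite -!expr2 cos2Dsin2.
rewrite /r /phi1 /phi2.
set q := expR _ in Qn *; set c := cos _ in cs *; set s := sin _ in cs *.
have -> : c * (q * (Q t * (zt t * c + w * (x t * s)) - S_ k1 t)) +
    s * (q * (Q t * (zt t * s - w * (x t * c)) - S_ k2 t)) =
  (q * Q t) * zt t * (c * c + s * s) - q * (c * S_ k1 t + s * S_ k2 t) by ring.
by rewrite Qn cs /zt; ring.
Unshelve. all: by end_near. Qed.

End Oscillator.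

Theorem mainTheorem9 (R : realType) (w : R) (p dp f x dx : R -> R) :
  0 < w ->
  (* p in C^1([0,oo)), derivative dp *)
  {within `[0%R, +oo[%classic, continuous p} ->
  (forall t : R, 0 < t -> is_derive t 1 p (dp t)) ->
  {within `[0%R, +oo[%classic, continuous dp} ->
  (forall t : R, 0 <= t -> 0 < p t) ->
  (forall t : R, 0 <= t -> dp t < 0) ->
  (\int[@lebesgue_measure R]_(s in `[0%R, +oo[%classic) (p s)%:E = +oo)%E ->
  (\int[@lebesgue_measure R]_(s in `[0%R, +oo[%classic) ((p s) ^+ 2)%:E < +oo)%E ->
  (* f in L^1_loc([0,oo)) *)
  (forall t : R, 0 <= t -> (@lebesgue_measure R).-integrable `[0, t] (EFin \o f)) ->
  (* x is the (Caratheodory) solution of x'' + p x' + w^2 x = f on [0,oo) *)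
  {within `[0%R, +oo[%classic, continuous x} ->
  (forall t : R, 0 < t -> is_derive t 1 x (dx t)) ->
  {within `[0%R, +oo[%classic, continuous dx} ->
  (forall t : R, 0 <= t ->
     dx t = dx 0 + Rint_ab 0 t (fun s => f s - p s * dx s - w ^+ 2 * x s)) ->
  (* hypotheses of the theorem *)
  x 0 = 0 -> dx 0 = 0 ->
  y1fun w f t @[t --> +oo%R] --> 0 ->
  x t @[t --> +oo%R] --> 0 ->
  (dx t @[t --> +oo%R] --> 0 <->
   Rint_ab 0 t (fun s => Efun p t s * L2fun w t s * y1fun w f s) @[t --> +oo%R] --> 0).

Proof.
move=> _ cp Hp _ p_gt0 dp_lt0 py _ f_int cx Hx cdx Hdx _ _ y0 x0.
have D := dx_sub_kernel_integral_cvg0 f_int cp Hp p_gt0 dp_lt0 py cx Hx cdx Hdx y0 x0.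
set I := fun t => Rint_ab 0 t _ in D *.
split=> [dx0|I0].
- have -> : I = (fun t => dx t - (dx t - I t)) by apply/funext => t; ring.
  by rewrite -(subr0 (0 : R)); exact: cvgB dx0 D.
- have -> : dx = (fun t => (dx t - I t) + I t) by apply/funext => t; ring.
  by rewrite -(addr0 (0 : R)); exact: cvgD D I0.
Qed.
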